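(* For every fixed integer $n\ge 1$, with $G_n=G_n(p)$ and $H_n=H_n(p)$ the extraspecial $p$-groups defined recursively in the context for each odd prime $p$, $$\lim_{p\to\infty}\mathcal{V}(G_n)=\lim_{p\to\infty}\mathcal{V}(H_n)=0,$$ where the limits are taken over odd primes $p$.
   Context: For a finite group $G$, $L(G)$ denotes the set of all subgroups of $G$ (including the trivial subgroup and $G$ itself), $s(G)$ denotes the number of subgroups of $G$ that are simple groups (the trivial group is not simple; cyclic groups of prime order are simple), and $\mathcal{V}(G)=s(G)/|L(G)|$. Let $p$ be an odd prime and $C_m$ the cyclic group of order $m$. Two families of finite extraspecial groups $\{G_n\}_{n\ge 0}$, $\{H_n\}_{n\ge 0}$ are defined recursively by $$G_0=C_{p^2}\rtimes C_p,\qquad G_{n+1}=(C_p\times G_n)\rtimes C_p,$$ $$H_0=(C_p\times C_p)\rtimes C_p,\qquad H_{n+1}=(C_p\times H_n)\rtimes C_p,$$ where at each step the semidirect product is of Heisenberg type, i.e. the action is chosen so that the resulting group is extraspecial (in particular $G_0$ and $H_0$ are the nonabelian groups of order $p^3$ of exponent $p^2$ and $p$ respectively, and $|G_n|=|H_n|=p^{2n+3}$). A $p$-group $E$ is extraspecial if its center $Z(E)$ has order $p$ and $E/Z(E)$ is a nontrivial elementary abelian $p$-group. *)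

(* Defs.v *)
From mathcomp Require Import boolp classical_sets reals topology normedtype.
From mathcomp Require Import all_boot all_fingroup all_solvable all_algebra.

Set Implicit Arguments.
Unset Strict Implicit.
Unset Printing Implicit Defensive.

Import numFieldNormedType.Exports.

Local Open Scope group_scope.

Definition num_simple_subgroups (gT : finGroupType) (G : {group gT}) : nat :=
  #|[set K in subgroups G | simple K]|.

Definition simple_ratio (R : realType) (gT : finGroupType) (G : {group gT}) : R :=
  ((num_simple_subgroups G)%:R / #|subgroups G|%:R)%R.

Section Families.

Variable p : nat.

Definition is_Cp2_Cp (gT : finGroupType) (G : {group gT}) : Prop :=
  extraspecial G /\
  exists A B : {group gT},
    [/\ cyclic A /\ #|A| = (p ^ 2)%N, cyclic B /\ #|B| = p & A ><| B = G].

Definition is_CpCp_Cp (gT : finGroupType) (G : {group gT}) : Prop :=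
  extraspecial G /\
  exists A1 A2 A B : {group gT},
    [/\ cyclic A1 /\ #|A1| = p, cyclic A2 /\ #|A2| = p, cyclic B /\ #|B| = p,
        A1 \x A2 = A & A ><| B = G].

(* The actions are not fixed: as in the informal definition, any action making
   the semidirect product extraspecial is allowed.  For odd p this determines
   the group up to isomorphism. *)
Fixpoint heisenberg_tower
    (base : forall gT : finGroupType, {group gT} -> Prop) (n : nat)
    (gT : finGroupType) (G : {group gT}) : Prop :=
  if n is n'.+1 then
    extraspecial G /\
    exists X K M Y : {group gT},
      [/\ cyclic X /\ #|X| = p, heisenberg_tower base n' K,
          cyclic Y /\ #|Y| = p, X \x K = M & M ><| Y = G]
  else base gT G.

Definition is_Gn := heisenberg_tower is_Cp2_Cp.
Definition is_Hn := heisenberg_tower is_CpCp_Cp.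

End Families.

Definition odd_primes_oo : set_system nat :=
  within [set p | prime p && odd p]%classic \oo%classic.

#[global] Instance odd_primes_oo_proper : ProperFilter odd_primes_oo.
Proof.
apply: Build_ProperFilter_ex => P [N _ NP].
have [p gtp pr_p] := prime_above (maxn N 2).
have [ltNp lt2p] : (N < p)%N /\ (2 < p)%N by apply/andP; rewrite -gtn_max.
exists p; apply: NP => /=; first exact: ltnW.
by rewrite pr_p; case: (even_prime pr_p) lt2p => // ->.
Qed.

(* The rest shows that groups satisfying is_Gn and is_Hn exist, so that a
   quantification over all of them is not vacuous. *)
Lemma heisenberg_tower_injm p base n (aT rT : finGroupType) (D : {group aT})
    (f : {morphism D >-> rT}) (G : {group aT}) :
  (forall K : {group aT}, K \subset D -> base aT K -> base rT (f @* K)%G) ->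
  'injm f -> G \subset D ->
  heisenberg_tower p base n G -> heisenberg_tower p base n (f @* G)%G.
Proof.
move=> baseJ injf; elim: n G => [|n IHn] G sGD /=; first exact: baseJ.
case=> esG [X [K [M [Y [[cX oX] tK [cY oY] dXK dMY]]]]].
have [sMG sYG] : M \subset G /\ Y \subset G.
  by have [_ <- _ _] := sdprodP dMY; rewrite mulG_subl mulG_subr.
have [sXM sKM] : X \subset M /\ K \subset M.
  by have [_ <- _ _] := dprodP dXK; rewrite mulG_subl mulG_subr.
have [sMD sYD] := (subset_trans sMG sGD, subset_trans sYG sGD).
have [sXD sKD] := (subset_trans sXM sMD, subset_trans sKM sMD).
split; first exact: (injm_extraspecial injf).
exists (f @* X)%G, (f @* K)%G, (f @* M)%G, (f @* Y)%G; split.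
- by rewrite card_injm // morphim_cyclic.
- exact: IHn.
- by rewrite card_injm // morphim_cyclic.
- exact: injm_dprod.
exact: injm_sdprod.
Qed.

Lemma is_Cp2_Cp_injm p (aT rT : finGroupType) (D : {group aT})
    (f : {morphism D >-> rT}) (G : {group aT}) :
  'injm f -> G \subset D -> is_Cp2_Cp p G -> is_Cp2_Cp p (f @* G)%G.
Proof.
move=> injf sGD [esG [A [B [[cA oA] [cB oB] dAB]]]].
have [sAG sBG] : A \subset G /\ B \subset G.
  by have [_ <- _ _] := sdprodP dAB; rewrite mulG_subl mulG_subr.
have [sAD sBD] := (subset_trans sAG sGD, subset_trans sBG sGD).
split; first exact: (injm_extraspecial injf).
exists (f @* A)%G, (f @* B)%G; split.
- by rewrite card_injm // morphim_cyclic.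
- by rewrite card_injm // morphim_cyclic.
exact: injm_sdprod.
Qed.

Lemma is_CpCp_Cp_injm p (aT rT : finGroupType) (D : {group aT})
    (f : {morphism D >-> rT}) (G : {group aT}) :
  'injm f -> G \subset D -> is_CpCp_Cp p G -> is_CpCp_Cp p (f @* G)%G.
Proof.
move=> injf sGD [esG [A1 [A2 [A [B [[cA1 oA1] [cA2 oA2] [cB oB] dA dAB]]]]]].
have [sAG sBG] : A \subset G /\ B \subset G.
  by have [_ <- _ _] := sdprodP dAB; rewrite mulG_subl mulG_subr.
have [sA1 sA2] : A1 \subset A /\ A2 \subset A.
  by have [_ <- _ _] := dprodP dA; rewrite mulG_subl mulG_subr.
have [sAD sBD] := (subset_trans sAG sGD, subset_trans sBG sGD).
have [sA1D sA2D] := (subset_trans sA1 sAD, subset_trans sA2 sAD).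
split; first exact: (injm_extraspecial injf).
exists (f @* A1)%G, (f @* A2)%G, (f @* A)%G, (f @* B)%G; split.
- by rewrite card_injm // morphim_cyclic.
- by rewrite card_injm // morphim_cyclic.
- by rewrite card_injm // morphim_cyclic.
- exact: injm_dprod.
exact: injm_sdprod.
Qed.

Section Existence.

Variable p : nat.
Hypotheses (p_pr : prime p) (p_odd : odd p).

Lemma index_p_sdprod (gT : finGroupType) (G M : {group gT}) (y : gT) :
  p.-group G -> M \subset G -> #|G| = (p * #|M|)%N -> y \in G -> y \notin M ->
  #[y] = p -> M ><| <[y]> = G.
Proof.
move=> pG sMG oG Gy notMy oy.
have iM : #|G : M| = p by rewrite -divgS // oG mulnK.
have nMG : G \subset 'N(M).
  apply: normal_norm (p_maximal_normal pG _).
  by apply: p_index_maximal; rewrite ?iM.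
have tiMy : M :&: <[y]> = 1.
  by rewrite setIC prime_TIg ?cycle_subG // -orderE oy.
rewrite sdprodE //; last by rewrite cycle_subG (subsetP nMG).
apply/eqP; rewrite eqEcard mul_subG ?cycle_subG //=.
by rewrite TI_cardMg // -orderE oy oG mulnC.
Qed.

Lemma prime_dprod (gT : finGroupType) (K : {group gT}) (x : gT) :
  x \in 'C(K) -> x \notin K -> #[x] = p ->
  <[x]> \x K = <[x]> <*> K /\ #|<[x]> <*> K| = (p * #|K|)%N.
Proof.
move=> cKx notKx ox.
have ti : <[x]> :&: K = 1 by rewrite prime_TIg ?cycle_subG // -orderE ox.
have c : K \subset 'C(<[x]>) by rewrite centsC cycle_subG.
rewrite dprodEY //; split=> //.
by rewrite cent_joinEr // TI_cardMg // -orderE ox.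
Qed.

Lemma pX1p2_gens (E : {group p^{1+2}}) : E :=: p^{1+2} ->
  exists x y, [/\ x \in E :\: 'Z(E), y \in E, y \notin 'C[x],
                  #[x] = p & #[y] = p].
Proof.
move=> defE; have expE : exponent E %| p by rewrite defE exponent_pX1p2.
have esE : extraspecial E by rewrite defE; apply: pX1p2_extraspecial.
have [x Ex notZx] : exists2 x, x \in E & x \notin 'Z(E).
  apply/subsetPn; apply: contra (extraspecial_nonabelian esE) => sEZ.
  by apply: subset_trans sEZ (subsetIr _ _).
have [y Ey ncxy] : exists2 y, y \in E & y \notin 'C[x].
  by apply/subsetPn; rewrite sub_cent1; rewrite inE Ex in notZx.
exists x, y; split=> //; first by rewrite inE notZx.
  by apply: nt_prime_order; rewrite ?(exponentP expE) ?(group1_contra notZx).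
by apply: nt_prime_order; rewrite ?(exponentP expE) ?(group1_contra ncxy).
Qed.

Lemma is_CpCp_Cp_exists : exists (gT : finGroupType) (G : {group gT}),
  p.-group G /\ is_CpCp_Cp p G.
Proof.
pose E := [set: p^{1+2}]%G; exists p^{1+2}%type, E; have pE := pX1p2_pgroup p_pr.
have esE := pX1p2_extraspecial p_pr.
split=> //; split=> //.
have oZ : #|'Z(E)| = p by apply: card_center_extraspecial.
have [x [y [/setDP[Ex notZx] Ey ncxy ox oy]]] := pX1p2_gens (erefl (gval E)).
have cZx : x \in 'C('Z(E)) by rewrite (subsetP _ x Ex) // centsC subsetIr.
have [dXZ oM] := prime_dprod cZx notZx ox.
pose M := (<[x]> <*> 'Z(E))%G.
have notMy : y \notin M.
  apply: contra ncxy; apply: (subsetP _).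
  rewrite join_subG cycle_subG cent1id /=.
  by rewrite sub_cent1 (subsetP _ x Ex) // centsC subsetIr.
exists <[x]>%G, 'Z(E)%G, M, <[y]>%G; split=> //.
- by rewrite cycle_cyclic -orderE.
- by rewrite prime_cyclic // oZ.
- by rewrite cycle_cyclic -orderE.
apply: index_p_sdprod => //; first exact: subsetT.
by rewrite card_pX1p2 // oM oZ !expnS muln1.
Qed.

Lemma is_Cp2_Cp_exists : exists (gT : finGroupType) (G : {group gT}),
  p.-group G /\ is_Cp2_Cp p G.
Proof.
pose G := [set: 'Mod_(p ^ 3)]%G; exists (modular_gtype (p ^ 3)), G.
have oG : #|G| = (p ^ 3)%N by rewrite /= card_modular_group.
have pG : p.-group G by rewrite /pgroup oG pnatX pnat_id.
have [[x y] gens modxy] :=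
  @generators_modular_group p 3 p_pr isT _ G (isog_refl _).
have [_ _ ox _] := gens; have [oy _] := modxy.
have [[dG nabG _] _ _ _ _] :=
  modular_group_structure p_pr (isT : 2 < 3)%N gens (isog_refl _) modxy.
split=> //; split.
  by apply: (p3group_extraspecial pG nabG); rewrite oG pfactorK.
by exists <[x]>%G, <[y]>%G; rewrite !cycle_cyclic -!orderE.
Qed.

Lemma heisenberg_tower_exists base n :
    (forall gT (G : {group gT}), base gT G -> extraspecial G) ->
    (forall (aT rT : finGroupType) (D : {group aT}) (f : {morphism D >-> rT})
       (G : {group aT}),
      'injm f -> G \subset D -> base aT G -> base rT (f @* G)%G) ->
    (exists (gT : finGroupType) (G : {group gT}), p.-group G /\ base gT G) ->
  exists (gT : finGroupType) (G : {group gT}),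
    p.-group G /\ heisenberg_tower p base n G.
Proof.
move=> base_es baseJ base_ex; elim: n => [|n [gT [K [pK tK]]]] //=.
have esK : extraspecial K by case: (n) tK => [/base_es|m []].
pose E := [set: p^{1+2}]%G; have pE : p.-group E by apply: pX1p2_pgroup.
have esE : extraspecial E by apply: pX1p2_extraspecial.
have oZE := card_center_extraspecial pE esE.
have oZK := card_center_extraspecial pK esK.
have isoZ : 'Z(E) \isog 'Z(K).
  by rewrite isog_cyclic_card ?prime_cyclic ?oZE ?oZK ?eqxx.
have [gz iso_gz] := xcprodP isoZ.
pose C := [set: cprod_by iso_gz]%G; exists _, C.
pose E' := (cpairg1 iso_gz @* E)%G; pose K' := (cpair1g iso_gz @* K)%G.
have [injE injK] := (injm_cpairg1 iso_gz, injm_cpair1g iso_gz).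
have defC : E' \* K' = C by apply: im_cpair_cprod.
have [_ defEK cEK] := cprodP defC.
have tiEK : E' :&: K' = 'Z(E') by apply: setI_im_cpair.
have pE' : p.-group E' by apply: morphim_pgroup.
have pK' : p.-group K' by apply: morphim_pgroup.
have pC : p.-group C by rewrite -defEK pgroupM pE'.
have esE' : extraspecial E' by apply: injm_extraspecial.
have esK' : extraspecial K' by apply: injm_extraspecial.
have oE : #|E| = (p ^ 3)%N by apply: card_pX1p2.
have oE' : #|E'| = (p ^ 3)%N by rewrite card_injm.
split=> //; split; first exact: (cprod_extraspecial pC defC).
have [x [y [/setDP[Ex notZx] Ey ncxy ox oy]]] := pX1p2_gens (erefl (gval E)).
pose x' := cpairg1 iso_gz x; pose y' := cpairg1 iso_gz y.
have Ex' : x' \in E' by apply: mem_morphim.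
have Ey' : y' \in E' by apply: mem_morphim.
have ox' : #[x'] = p by rewrite order_injm.
have oy' : #[y'] = p by rewrite order_injm.
have ncxy' : y' \notin 'C[x'].
  apply: contra ncxy => /cent1P cxy; apply/cent1P.
  by apply: (injmP injE); rewrite ?groupM // !morphM.
have notKx' : x' \notin K'.
  apply: contra ncxy' => Kx'; have : x' \in 'Z(E') by rewrite -tiEK inE Ex'.
  by case/centerP=> _ /(_ y' Ey') cxy; apply/cent1P.
have cKx' : x' \in 'C(K') by rewrite (subsetP _ x' Ex') // centsC.
have [dXK oM] := prime_dprod cKx' notKx' ox'.
pose M := (<[x']> <*> K')%G.
have notMy' : y' \notin M.
  apply: contra ncxy'; apply: (subsetP _); rewrite join_subG cycle_subG cent1id.
  by rewrite sub_cent1.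
exists <[x']>%G, K', M, <[y']>%G; split=> //.
- by rewrite cycle_cyclic -orderE.
- by apply: heisenberg_tower_injm => // H; apply: baseJ.
- by rewrite cycle_cyclic -orderE.
apply: index_p_sdprod => //; rewrite ?subsetT ?inE //.
have := mul_cardG E' K'; rewrite defEK tiEK (card_center_extraspecial pE' esE').
rewrite oM oE' !expnS muln1 => /eqP.
by rewrite [(#|C| * p)%N]mulnC -!mulnA eqn_pmul2l ?prime_gt0 // eq_sym => /eqP.
Qed.

Theorem is_Gn_exists n :
  exists (gT : finGroupType) (G : {group gT}), is_Gn p n G.
Proof.
have [||gT [G [_ tG]]] := heisenberg_tower_exists n _ _ is_Cp2_Cp_exists.
- by move=> ? ? [].
- by move=> *; apply: is_Cp2_Cp_injm.
by exists gT, G.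
Qed.

Theorem is_Hn_exists n :
  exists (gT : finGroupType) (G : {group gT}), is_Hn p n G.
Proof.
have [||gT [G [_ tG]]] := heisenberg_tower_exists n _ _ is_CpCp_Cp_exists.
- by move=> ? ? [].
- by move=> *; apply: is_CpCp_Cp_injm.
by exists gT, G.
Qed.

End Existence.

(* Main.v *)
(* Let G be extraspecial of order q = p^(2n+3) >= p^5 with p odd; its simple
   subgroups have order p, so there are at most |Ohm_1(G)| / (p - 1) of them,
   and Ohm_1(G) has exponent p and index 1 or p in G.  Subgroups are counted
   from below by pairs (x, y), as a subgroup of order m contains m^2 of them.
   - Each <x, y, Z(G)> has order at most p^3, hence |L(G)| >= q^2 / p^6, which
     is at least q / p = |Ohm_1(G)| when the index is p.
   - If G has exponent p, each of the at least q^2 / p commuting pairs generates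
     a subgroup of order at most p^2, hence |L(G)| >= q^2 / p^5 >= q.
   In both cases V(G) <= 1 / (p - 1). *)
Require Import Defs.
From mathcomp Require Import boolp classical_sets reals topology normedtype.
From mathcomp Require Import all_boot all_fingroup all_solvable all_algebra.
From mathcomp Require Import all_order.

Import numFieldNormedType.Exports.
Import Order.TTheory GRing.Theory Num.Theory GroupScope.

(** * Orders of the groups in the two families *)

Lemma heisenberg_tower_extraspecial
    (base : forall gT : finGroupType, {group gT} -> Prop) p n
    (gT : finGroupType) (G : {group gT}) :
  (forall gT (K : {group gT}),
     base gT K -> extraspecial K /\ #|K| = (p ^ 3)%N) ->
  heisenberg_tower p base n G ->
  extraspecial G /\ #|G| = (p ^ n.*2.+3)%N.
Proof.
move=> baseP; elim: n gT G => [|n IHn] gT G; first exact: baseP.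
case=> esG [X [K [M [Y [[_ oX] /IHn[_ oK] [_ oY] dXK dMY]]]]]; split=> //.
rewrite -(sdprod_card dMY) -(dprod_card dXK) oX oY oK.
by rewrite mulnC !expnS.
Qed.

Lemma is_Cp2_Cp_extraspecial p (gT : finGroupType) (G : {group gT}) :
  is_Cp2_Cp p G -> extraspecial G /\ #|G| = (p ^ 3)%N.
Proof.
case=> esG [A [B [[_ oA] [_ oB] dAB]]]; split=> //.
by rewrite -(sdprod_card dAB) oA oB -expnSr.
Qed.

Lemma is_CpCp_Cp_extraspecial p (gT : finGroupType) (G : {group gT}) :
  is_CpCp_Cp p G -> extraspecial G /\ #|G| = (p ^ 3)%N.
Proof.
case=> esG [A1 [A2 [A [B [[_ o1] [_ o2] [_ oB] dA dAB]]]]]; split=> //.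
by rewrite -(sdprod_card dAB) -(dprod_card dA) o1 o2 oB !expnS muln1 mulnA.
Qed.

(** Double counting over the fibres of [f]: all pairs sent to [K] lie in [K] x [K], which has at
    most [m ^ 2] elements. *)
Lemma card_pairs_le_subgroups (gT : finGroupType) (G : {group gT}) m
    (D : {set gT * gT}) (f : gT * gT -> {group gT}) :
  (forall u, u \in D ->
     [/\ f u \subset G, u.1 \in f u, u.2 \in f u & #|f u| <= m]) ->
  #|D| <= m ^ 2 * #|subgroups G|.
Proof.
move=> fP; rewrite -sum1_card.
rewrite (partition_big f (mem (subgroups G))) /=; last first.
  by move=> u /fP[sfG _ _ _]; rewrite inE.
rewrite mulnC -sum_nat_const; apply: leq_sum => K _.
(* The bound on [#|K|] is available only when [K] is a value of [f], so empty fibres are set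
   apart. *)
have [u0 /andP[Du0 /eqP fu0] | noK] :=
  pickP [pred u | (u \in D) && (f u == K)]; last first.
  by rewrite big_pred0.
have [_ _ _ lefm] := fP _ Du0; rewrite fu0 in lefm.
rewrite sum1_card; apply: (@leq_trans #|setX K K|).
  apply: subset_leq_card; apply/fintype.subsetP => u.
  by rewrite unfold_in => /andP[/fP[_ u1 u2 _]] /eqP <-; rewrite inE u1.
by rewrite cardsX -mulnn leq_mul.
Qed.

(** * Simple subgroups against all subgroups *)

Section Extraspecial.

Variables (p : nat) (gT : finGroupType) (G : {group gT}).
Hypotheses (p_pr : prime p) (pG : p.-group G).

(** Distinct subgroups of order [p] meet trivially, and each contributes [p.-1] elements of order
    [p], all in ['Ohm_1(G)]. *)
Lemma num_simple_subgroups_Ohm1 :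
  num_simple_subgroups G * p.-1 <= #|'Ohm_1(G)|.
Proof.
have simpleP K : K \in [set K in subgroups G | simple K] ->
    K \subset G /\ #|K| = p.
  rewrite !inE => /andP[sKG simK]; split=> //.
  have pK := pgroupS sKG pG.
  have pr_K := simple_sol_prime (pgroup_sol pK) simK.
  by apply/eqP; move: pK; rewrite /pgroup pnatE // inE.
rewrite -sum_nat_const (eq_bigr (fun K : {group gT} => #|K^#|)); last first.
  move=> K /simpleP[_ oK].
  by rewrite (cardsD1 1 K) group1 /= in oK; rewrite -oK.
(* The inner sum counts the generators of [K]; since [#|K|] is prime, every nonidentity element of
   [K] is one. *)
apply: (@leq_trans (\sum_(K in [set K in subgroups G | simple K])
   \sum_(x in 'Ohm_1(G) | <[x]>%G == K) 1)).
  apply: leq_sum => K /simpleP[sKG oK]; rewrite sum1_card.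
  apply: subset_leq_card; apply/fintype.subsetP => x /setD1P[ntx Kx].
  have genK : <[x]> = K.
    apply/eqP; rewrite eqEsubset cycle_subG Kx /= prime_meetG ?oK //.
    by apply/trivgPn; exists x; rewrite // inE Kx cycle_id.
  have ox : #[x] = p by rewrite orderE genK.
  rewrite unfold_in -val_eqE /= genK eqxx andbT Ohm1Eprime mem_gen //.
  by rewrite inE (fintype.subsetP sKG) // ox.
rewrite -sum1_card.
(* Elements whose cyclic subgroup is not simple, such as 1, are split off here and dropped by
   [leq_addr]. *)
rewrite (bigID (fun x => <[x]>%G \in [set K in subgroups G | simple K])) /=.
rewrite (partition_big (fun x => <[x]>%G)
  (mem [set K in subgroups G | simple K])) /=; last by move=> x /andP[].
apply: leq_trans (leq_addr _ _); apply: leq_sum => K SK.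
rewrite leq_eqVlt; apply/orP; left; apply/eqP; apply: eq_bigl => x.
by case: eqP => [-> | _]; rewrite ?SK ?andbT ?andbF.
Qed.

Hypothesis esG : extraspecial G.

Lemma sq_card_extraspecial_le : #|G| ^ 2 <= p ^ 6 * #|subgroups G|.
Proof.
have [[defPhi _] _] := esG.
have oZ := card_center_extraspecial pG esG.
have abGZ : p.-abelem (G / 'Z(G)) by rewrite -defPhi Phi_quotient_abelem.
pose Q (x : gT) := <[coset 'Z(G) x]>.
have nZ x : x \in G -> x \in 'N('Z(G)).
  by apply/fintype.subsetP: x; apply: normal_norm; apply: center_normal.
have sQ x : x \in G -> Q x \subset G / 'Z(G).
  by move=> Gx; rewrite cycle_subG mem_quotient.
have oQ x : x \in G -> #|Q x| <= p.
  move=> Gx; apply: dvdn_leq; first exact: prime_gt0.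
  rewrite -orderE order_dvdn; apply/eqP.
  by apply: (abelemP p_pr abGZ).2; apply: mem_quotient.
(* This is the subgroup generated by [u.1], [u.2] and ['Z(G)]; as a preimage, its order is [p] times
   an order in the elementary abelian quotient. *)
pose f (u : gT * gT) := (coset 'Z(G) @*^-1 (Q u.1 <*> Q u.2))%G.
rewrite -mulnn -cardsX (expnM p 3 2).
apply: (@card_pairs_le_subgroups _ _ _ _ f) => -[x y] /setXP[/= Gx Gy].
have Zx : x \in 'N('Z(G)) := nZ x Gx; have Zy : y \in 'N('Z(G)) := nZ y Gy.
split=> /=.
- apply: (@fintype.subset_trans _ _ (coset 'Z(G) @*^-1 (G / 'Z(G)))).
    by rewrite cosetpreSK join_subG !sQ.
  by rewrite quotientGK ?center_normal.
- by rewrite mem_morphpre //= mem_gen // inE cycle_id.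
- by rewrite mem_morphpre //= mem_gen // inE cycle_id orbT.
rewrite card_cosetpre oZ expnS leq_mul2l; apply/orP; right.
rewrite /= cent_joinEr; last first.
  by rewrite (sub_abelian_cent2 (abelem_abelian abGZ)) ?sQ.
apply: (@leq_trans (#|Q x| * #|Q y|)).
  by rewrite mul_cardG leq_pmulr.
by rewrite -mulnn leq_mul ?oQ.
Qed.

Lemma sq_card_extraspecial_exponent_le :
  exponent G %| p -> #|G| ^ 2 <= p ^ 5 * #|subgroups G|.
Proof.
move=> /exponentP expG.
pose D := [set u in setX G G | u.2 \in 'C[u.1]].
(* A noncentral element has a maximal centralizer, hence of index [p]; summing over [x] bounds the
   number of commuting pairs. *)
have le_cent x : x \in G -> #|G| <= p * #|'C_G[x]|.
  move=> Gx; have [Zx | notZx] := boolP (x \in 'Z(G)).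
    have -> : 'C_G[x] = G; last by rewrite leq_pmull ?prime_gt0.
    by apply/setIidPl; rewrite sub_cent1; case/setIP: Zx.
  have maxC := cent1_extraspecial_maximal esG Gx notZx.
  by rewrite -(Lagrange (subsetIl G 'C[x])) (p_maximal_index pG maxC) mulnC.
have oD : #|G| ^ 2 <= p * #|D|.
  have -> : #|D| = \sum_(x in G) #|'C_G[x]|.
    under eq_bigr do rewrite -sum1_card.
    rewrite pair_big_dep /= -sum1_card; apply: eq_bigl => -[x y].
    by rewrite !inE /= andbA.
  by rewrite big_distrr /= -mulnn -sum_nat_const leq_sum.
apply: leq_trans oD _; rewrite (expnS p 4) -mulnA leq_mul2l; apply/orP; right.
pose f (u : gT * gT) := (<[u.1]> <*> <[u.2]>)%G.
rewrite (expnM p 2 2); apply: (@card_pairs_le_subgroups _ _ _ _ f) => -[x y].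
rewrite inE in_setX /= => /andP[/andP[Gx Gy] cxy]; split.
- by rewrite join_subG !cycle_subG Gx.
- by rewrite mem_gen // inE cycle_id.
- by rewrite mem_gen // inE cycle_id orbT.
have oc z : z \in G -> #[z] <= p.
  move=> Gz; apply: dvdn_leq; first exact: prime_gt0.
  by rewrite order_dvdn expG.
rewrite /f /= cent_joinEr; last by rewrite cent_cycle cycle_subG.
apply: (@leq_trans (#[x] * #[y])); first by rewrite !orderE mul_cardG leq_pmulr.
by rewrite -mulnn leq_mul ?oc.
Qed.

Lemma num_simple_subgroups_extraspecial_le :
  odd p -> p ^ 5 <= #|G| -> num_simple_subgroups G * p.-1 <= #|subgroups G|.
Proof.
move=> p_odd leG; apply: leq_trans num_simple_subgroups_Ohm1 _.
have oddG : odd #|G| by have /p_natP[k ->] := pG; rewrite oddX p_odd orbT.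
(* For odd [p], ['Ohm_1(G)] has exponent [p] and index dividing [p]. *)
have [expY iY _] := Ohm1_extraspecial_odd pG esG oddG.
have [eqYG | neqYG] := eqVneq 'Ohm_1(G) (G : {set gT}).
  rewrite eqYG -(@leq_pmul2l (p ^ 5)) ?expn_gt0 ?prime_gt0 //.
  apply: leq_trans (sq_card_extraspecial_exponent_le _); last first.
    by rewrite -eqYG expY.
  by rewrite -mulnn leq_mul.
have defG : (#|'Ohm_1(G)| * p)%N = #|G|.
  rewrite -(Lagrange (Ohm_sub 1 G)); congr (_ * _)%N.
  case/primeP: p_pr => _ /(_ _ iY) /pred2P[]// /eqP.
  rewrite indexg_eq1 => sGY; case/eqP: neqYG.
  by apply/eqP; rewrite eqEsubset Ohm_sub.
(* With [q] the order of [G], [defG] turns the left side into [p ^ 5 * q], which is at most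
   [q ^ 2]. *)
rewrite -(@leq_pmul2l (p ^ 6)) ?expn_gt0 ?prime_gt0 //.
apply: leq_trans sq_card_extraspecial_le.
by rewrite expnSr -mulnA [(p * _)%N]mulnC defG -mulnn leq_mul.
Qed.

End Extraspecial.

(** * Passage to the limit *)

Local Open Scope classical_set_scope.
Local Open Scope ring_scope.

Lemma simple_ratio_cvg0 (R : realType) (gT : nat -> finGroupType)
    (G : forall p, {group gT p}) :
  (forall p, prime p -> odd p ->
     num_simple_subgroups (G p) * p.-1 <= #|subgroups (G p)|)%N ->
  simple_ratio R (G p) @[p --> odd_primes_oo] --> (0 : R).
Proof.
move=> leG; apply/cvgrPdist_le => e e_gt0.
have [N _ NP] := nbhs_infty_ger (e^-1 : R).
(* The successor is needed because the Archimedean bound is applied to [p.-1]. *)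
exists N.+1 => // p /= ltNp /andP[p_pr p_odd].
have lt0L : (0 < #|subgroups (G p)|%:R :> R).
  by rewrite ltr0n; apply/card_gt0P; exists 1%G; rewrite inE sub1G.
have lep1 : e^-1 <= p.-1%:R by apply: NP; rewrite /= -ltnS prednK ?prime_gt0.
rewrite sub0r normrN ger0_norm; last by rewrite divr_ge0.
rewrite ler_pdivrMr //.
have := leG p p_pr p_odd; rewrite -(ler_nat R) natrM => le_sL.
rewrite -ler_pdivrMl //; apply: le_trans le_sL.
by rewrite mulrC ler_wpM2l.
Qed.

Theorem proposition2p15 (R : realType) (n : nat) (n_ge1 : (1 <= n)%N)
    (gT hT : nat -> finGroupType)
    (G : forall p : nat, {group gT p}) (H : forall p : nat, {group hT p})
    (Gn : forall p : nat, prime p -> odd p -> is_Gn p n (G p))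
    (Hn : forall p : nat, prime p -> odd p -> is_Hn p n (H p)) :
  (simple_ratio R (G p) @[p --> odd_primes_oo] --> (0 : R)) /\
  (simple_ratio R (H p) @[p --> odd_primes_oo] --> (0 : R)).
Proof.
have bound p (kT : finGroupType) (K : {group kT}) : prime p -> odd p ->
    extraspecial K /\ #|K| = (p ^ n.*2.+3)%N ->
  (num_simple_subgroups K * p.-1 <= #|subgroups K|)%N.
  move=> p_pr p_odd [esK oK].
  apply: num_simple_subgroups_extraspecial_le => //.
    by rewrite /pgroup oK pnatX pnat_id.
  (* Here [n_ge1] enters: it makes the exponent 2n+3 at least 5. *)
  by rewrite oK leq_pexp2l ?prime_gt0 // !ltnS (leq_double 1 n).
split; apply: simple_ratio_cvg0 => p p_pr p_odd; apply: bound => //.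
  apply: heisenberg_tower_extraspecial (Gn p p_pr p_odd) => kT K.
    exact: is_Cp2_Cp_extraspecial.
apply: heisenberg_tower_extraspecial (Hn p p_pr p_odd) => kT K.
  exact: is_CpCp_Cp_extraspecial.
Qed.
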